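(* There exist a non-complete Hausdorff locally convex complex topological vector space $E$ and a convex bounded subset $\mathcal{C}\subset E$ which is $\sigma(E,E^* )$-closed, such that $\mathcal{C}$ is not $\sigma(E,E^* )$-compact, although every $\varphi\in E^*$ attains its supremum over $\mathcal{C}$, i.e. for every $\varphi\in E^*$ there is $x\in\mathcal{C}$ with $|\varphi(x)|=\sup_{y\in\mathcal{C}}|\varphi(y)|$.
   Context: $E^*$ denotes the space of all continuous linear functionals on the locally convex space $E$, and $\sigma(E,E^* )$ is the weak topology on $E$, i.e. the coarsest topology making every $\varphi\in E^*$ continuous. Completeness of $E$ means completeness with respect to the uniform structure of the topological vector space $E$ (every Cauchy net converges). A subset is bounded if it is absorbed by every neighbourhood of $0$. *)

(* Defs.v *)
From HB Require Import structures.
From mathcomp Require Import all_boot all_order all_algebra.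
From mathcomp Require Import complex.
From mathcomp Require Import all_classical all_reals all_analysis.

Set Implicit Arguments.
Unset Strict Implicit.
Unset Printing Implicit Defensive.

Import Order.TTheory GRing.Theory Num.Theory.
Import numFieldTopology.Exports.

Local Open Scope classical_set_scope.
Local Open Scope ring_scope.

(* A tvsType K is a locally convex topological vector space, not necessarily
   Hausdorff. It also carries a uniform structure inducing its topology, but
   that structure is not required to be translation invariant, so it need not
   be the uniform structure of the topological vector space. The latter is
   therefore spelled out here, and completeness refers to it. *)
Definition tvs_entourage (K : numDomainType) (E : topologicalLmodType K) :
    set_system (E * E) :=
  [set A | exists2 U : set E, nbhs (0 : E) U &
           forall x y : E, U (x - y) -> A (x, y)].

Definition tvs_complete (K : numDomainType) (E : topologicalLmodType K) : Prop :=
  forall F : set_system E, ProperFilter F ->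
    (F, F) --> tvs_entourage (E := E) -> exists x : E, F --> x.

Definition tvs_bounded (K : numDomainType) (E : topologicalLmodType K)
    (C : set E) : Prop :=
  forall U : set E, nbhs (0 : E) U ->
    exists2 r : K, 0 < r &
      forall t : K, r <= `|t| -> C `<=` [set t *: u | u in U].

Definition dual (K : numFieldType) (E : topologicalLmodType K) : Type :=
  {phi : {linear E -> K^o} | continuous (phi : E -> K^o)}.

(* sigma(E, E^* ): E equipped with the supremum of the initial topologies of
   the continuous linear functionals. *)
Definition weak (K : numFieldType) (E : topologicalLmodType K) :
    topologicalType :=
  sup_topology (fun phi : dual E =>
    Topological.class (initial_topology (sval phi : E -> K^o))).

(* Main.v *)
(* Take for [E] the finitely supported complex sequences with the topology of
   coordinatewise convergence, and for [C] the sequences with all coordinates of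
   modulus at most 1. A continuous functional depends on finitely many
   coordinates only, so it attains the supremum of its modulus on [C] at a
   finite sequence of numbers of modulus 0 or 1, while the sequences
   (1, ..., 1, 0, ...) form a Cauchy sequence in [C] that has no cluster point,
   even weakly, because the coordinates are continuous functionals. *)
From HB Require Import structures.
Require Import Defs.
From mathcomp Require Import all_boot all_order all_algebra.
From mathcomp Require Import ring.
From mathcomp Require Import complex.
From mathcomp Require Import all_classical all_reals all_analysis.

Set Implicit Arguments.
Unset Strict Implicit.
Unset Printing Implicit Defensive.

Import Order.TTheory GRing.Theory Num.Theory.
Import numFieldTopology.Exports.

Local Open Scope classical_set_scope.
Local Open Scope ring_scope.

(* The polynomial ring serves only as a ready-made space of finitely supported
   sequences. *)
Definition finseq (K : numFieldType) : Type := {poly K}.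

HB.instance Definition _ (K : numFieldType) :=
  GRing.Lmodule.copy (finseq K) {poly K}.

(** * Coordinates and the topology of coordinatewise convergence *)

Section Finseq.
Variable K : numFieldType.
Implicit Types (x y : finseq K) (n i : nat) (e : K).

Definition coord i x : K := (x : {poly K})`_i.

Lemma coordD i x y : coord i (x + y) = coord i x + coord i y.
Proof. exact: coefD. Qed.

Lemma coordZ i (k : K) x : coord i (k *: x) = k * coord i x.
Proof. exact: coefZ. Qed.

Lemma coordB i x y : coord i (x - y) = coord i x - coord i y.
Proof. exact: coefB. Qed.

Lemma coord0 i : coord i 0 = 0.
Proof. exact: coef0. Qed.

(** Basic neighbourhoods of the topology induced by the product: for [e > 0] a box contains [x] plus
    every sequence supported on indices from [n] on. *)
Definition box x n e : set (finseq K) :=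
  [set y | forall i, (i < n)%N -> `|coord i x - coord i y| < e].

Definition finseq_nbhs x : set_system (finseq K) :=
  [set A | exists n e, 0 < e /\ box x n e `<=` A].

HB.instance Definition _ := hasNbhs.Build (finseq K) finseq_nbhs.

Lemma nbhs_box x n e : 0 < e -> nbhs x (box x n e).
Proof. by move=> e0; exists n, e; split. Qed.

Lemma box_center x n e : 0 < e -> box x n e x.
Proof. by move=> e0 i _; rewrite subrr normr0. Qed.

Lemma sub_box x n e n' e' :
  (n <= n')%N -> e' <= e -> box x n' e' `<=` box x n e.
Proof.
move=> nn' ee' y yx i iltn.
exact: lt_le_trans (yx i (leq_trans iltn nn')) ee'.
Qed.

Lemma finseq_nbhs_filter x : ProperFilter (nbhs x).
Proof.
split.
  by move=> [n [e [e0 /(_ x (@box_center x n e e0))]]].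
split.
- by exists 0%N, 1.
- move=> A B [n [e [e0 nA]]] [m [d [d0 mB]]].
  (* The order of [K] is partial, but positive elements are real and hence comparable. *)
  have [ed|de] := orP (real_leVge (gtr0_real e0) (gtr0_real d0)).
    exists (maxn n m), e; split=> // y yx; split.
      by apply/nA/(sub_box _ _ yx); rewrite ?leq_maxl.
    by apply/mB/(sub_box _ _ yx); rewrite ?leq_maxr.
  exists (maxn n m), d; split=> // y yx; split.
    by apply/nA/(sub_box _ _ yx); rewrite ?leq_maxl.
  by apply/mB/(sub_box _ _ yx); rewrite ?leq_maxr.
- move=> A B AB [n [e [e0 nA]]]; exists n, e; split=> //.
  exact: subset_trans AB.
Qed.

Lemma finseq_nbhs_singleton x A : nbhs x A -> A x.
Proof. by move=> [n [e [e0 nA]]]; exact/nA/box_center. Qed.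

(** Each of the finitely many strict inequalities leaves some slack; the smallest one serves as [d].
    Hence boxes are open. *)
Lemma box_slack x n e y :
  box x n e y -> exists2 d, 0 < d & box y n d `<=` box x n e.
Proof.
elim: n => [|n IHn] yx; first by exists 1.
have [|d d0 dyx] := IHn; first by move=> i iltn; apply: yx; exact: ltnW.
have s0 : 0 < e - `|coord n x - coord n y| by rewrite subr_gt0 yx.
pose s := e - `|coord n x - coord n y|.
suff [r [r0 rd rs]] : exists r, [/\ 0 < r, r <= d & r <= s].
  exists r => // z zy i; rewrite ltnS leq_eqVlt => /predU1P[->|iltn].
    rewrite -(subrKA (coord n y)) (le_lt_trans (ler_normD _ _))//.
    by rewrite -ltrBrDl (lt_le_trans (zy _ (ltnSn n))).
  apply: (dyx z) => // j jltn.
  exact: lt_le_trans (zy j (ltnW jltn)) rd.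
have [ds|sd] := orP (real_leVge (gtr0_real d0) (gtr0_real s0)).
  by exists d.
by exists s.
Qed.

Lemma finseq_nbhs_nbhs x A : nbhs x A -> nbhs x (nbhs^~ A).
Proof.
move=> [n [e [e0 nA]]]; exists n, e; split=> // y /box_slack[d d0 yx].
by exists n, d; split=> //; exact: subset_trans nA.
Qed.

HB.instance Definition _ := Nbhs_isNbhsTopological.Build (finseq K)
  finseq_nbhs_filter finseq_nbhs_singleton finseq_nbhs_nbhs.

Lemma coord_continuous i : continuous (coord i : finseq K -> K^o).
Proof.
move=> x A /nbhs_ballP[e e0 eA]; exists i.+1, e; split=> // y yx.
by apply: eA; rewrite -ball_normE; exact: yx.
Qed.

(** A box imposes finitely many conditions, each of which holds eventually. This reduces continuity
    of the operations to that in [K]. *)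
Lemma cvg_finseq (F : set_system (finseq K)) (FF : Filter F) x :
  (forall i, (coord i y : K^o) @[y --> F] --> (coord i x : K^o)) -> F --> x.
Proof.
move=> Fx A [n [e [e0 nA]]]; apply: filterS nA _.
elim: n => [|n IHn]; first by apply: filterS filterT.
have /cvgrPdist_lt/(_ e e0) := Fx n; rewrite near_simpl => Fn.
apply: filterS2 IHn Fn => y yn yx i; rewrite ltnS leq_eqVlt => /predU1P[->//|].
exact: yn.
Qed.

(** * Continuity of the operations, local convexity, separation *)

Lemma finseq_add_continuous :
  continuous (fun x : finseq K * finseq K => x.1 + x.2).
Proof.
move=> [x y]; apply: cvg_finseq => i /=.
rewrite coordD.
change ((fun z : finseq K * finseq K => coord i (z.1 + z.2) : K^o) @ (x, y) -->
  (coord i x + coord i y : K^o)).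
under eq_cvg do rewrite coordD.
apply: cvgD.
  apply: (@cvg_comp _ _ _ fst (coord i : _ -> K^o) _ (nbhs x)).
    exact: cvg_fst.
  exact: coord_continuous.
apply: (@cvg_comp _ _ _ snd (coord i : _ -> K^o) _ (nbhs y)).
  exact: cvg_snd.
exact: coord_continuous.
Qed.

Lemma finseq_scale_continuous :
  continuous (fun z : K^o * finseq K => z.1 *: z.2).
Proof.
move=> [k x]; apply: cvg_finseq => i /=.
rewrite coordZ.
change ((fun z : K^o * finseq K => coord i (z.1 *: z.2) : K^o) @ (k, x) -->
  (k * coord i x : K^o)).
under eq_cvg do rewrite coordZ.
apply: cvgM; first exact: cvg_fst.
apply: (@cvg_comp _ _ _ snd (coord i : _ -> K^o) _ (nbhs x)).
  exact: cvg_snd.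
exact: coord_continuous.
Qed.

Lemma coord_conv i x y (k : {i01 K}) :
  coord i (conv k (x : convex_lmodType _) (y : convex_lmodType _)) =
  k%:num * coord i x + (1 - k%:num) * coord i y.
Proof. by rewrite /conv/= coordD !coordZ. Qed.

Lemma box_convex x n e : convex_set (box x n e).
Proof.
apply/convex_setW => y z; rewrite !inE => yx zx k k0 k1; rewrite inE => i iltn.
have k1' : 0 < 1 - k%:num by rewrite subr_gt0.
rewrite coord_conv [X in `|X|](_ : _ = k%:num * (coord i x - coord i y) +
    (1 - k%:num) * (coord i x - coord i z)); last by ring.
rewrite (le_lt_trans (ler_normD _ _))// !normrM.
rewrite (gtr0_norm k0) (gtr0_norm k1').
rewrite (_ : e = k%:num * e + (1 - k%:num) * e); last by ring.
by apply: ltrD; rewrite ltr_pM2l//; [exact: yx|exact: zx].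
Qed.

Lemma finseq_locally_convex : exists2 B : set_system (finseq K),
  (forall b, b \in B -> convex_set b) & basis B.
Proof.
exists [set B | exists x n e, B = box x n e].
  by move=> B /[!inE] -[x [n [e ->]]]; exact: box_convex.
split.
  move=> _ [x [n [e ->]]]; rewrite openE => y /box_slack[d d0 dyx].
  by exists n, d.
move=> x A [n [e [e0 nA]]]; exists (box x n e) => //; split.
  by exists x, n, e.
exact: box_center.
Qed.

(* This factory only declares the uniform structure; the other instances do not
   come with it. *)
HB.instance Definition _ := PreTopologicalLmod_isTvs.Build K (finseq K)
  finseq_add_continuous finseq_scale_continuous finseq_locally_convex.
HB.instance Definition _ := PreTopologicalNmodule_isTopologicalNmodule.Build
  (finseq K) finseq_add_continuous.
HB.instance Definition _ := TopologicalNmodule_isTopologicalLmodule.Build K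
  (finseq K) finseq_scale_continuous.
HB.instance Definition _ := Uniform_isTvs.Build K (finseq K)
  finseq_locally_convex.

Lemma finseq_hausdorff : hausdorff_space (finseq K).
Proof.
move=> x y xy; apply/polyP => i; apply/eqP/negPn/negP => xyi.
(* Boxes of half this distance are disjoint; they need length [i.+1] to constrain coordinate [i]. *)
have d0 : 0 < `|coord i x - coord i y| / 2.
  by rewrite divr_gt0// normr_gt0 subr_eq0.
have [z [zx zy]] := xy _ _ (nbhs_box x i.+1 d0) (nbhs_box y i.+1 d0).
have := ltrD (zx i (ltnSn i)) (zy i (ltnSn i)).
rewrite -splitr (distrC (coord i y)) => /(le_lt_trans (ler_distD _ _ _)).
by rewrite ltxx.
Qed.

(** * The unit cube: convexity and boundedness *)

Definition unit_cube : set (finseq K) := [set x | forall i, `|coord i x| <= 1].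

Lemma unit_cube_convex : convex_set unit_cube.
Proof.
move=> x y k; rewrite !inE => x1 y1 i; rewrite coord_conv.
have k0 : 0 <= k%:num by [].
have k1 : 0 <= 1 - k%:num by rewrite subr_ge0.
rewrite (le_trans (ler_normD _ _))// !normrM (ger0_norm k0) (ger0_norm k1).
rewrite [leRHS](_ : 1 = k%:num * 1 + (1 - k%:num) * 1); last by ring.
by rewrite lerD// ler_wpM2l.
Qed.

Lemma unit_cube_bounded : tvs_bounded unit_cube.
Proof.
(* The factor 2 makes the inequality strict: coordinates are at most [1 < 2 <= |t| * e]. *)
move=> U [n [e [e0 nU]]]; exists (2 / e); first by rewrite divr_gt0.
move=> t et x x1; have t0 : 0 < `|t| by rewrite (lt_le_trans _ et)// divr_gt0.
have tN0 : t != 0 by rewrite -normr_gt0.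
exists (t^-1 *: x); last by rewrite scalerA divff// scale1r.
apply: nU => i _; rewrite coord0 sub0r normrN coordZ normrM normfV.
rewrite ltr_pdivrMl//; apply: le_lt_trans (x1 i) _.
apply: (@lt_le_trans _ _ (2 / e * e)); last by rewrite ler_wpM2r// ltW.
by rewrite divfK ?gt_eqF// ltr1n.
Qed.

(** * The weak topology and weak closedness of the cube *)

Lemma coord_is_linear i : linear (coord i : finseq K -> K^o).
Proof. by move=> k x y; rewrite coordD coordZ. Qed.

HB.instance Definition _ i := GRing.isLinear.Build K (finseq K) K^o _
  (coord i : finseq K -> K^o) (coord_is_linear i).

Definition coord_dual i : dual (finseq K) :=
  exist _ (coord i : {linear finseq K -> K^o}) (@coord_continuous i).

(** The weak topology refines the initial topology of each continuous functional, in particular of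
    each coordinate. *)
Lemma nbhs_weak_coord i (x : finseq K) e : 0 < e ->
  nbhs (x : weak (finseq K)) [set y | `|coord i x - coord i y| < e].
Proof.
move=> e0.
have /cvg_sup/(_ (coord_dual i)) :
    nbhs (x : weak (finseq K)) --> (x : weak (finseq K)) by exact: cvg_id.
apply.
apply: (@initial_continuous _ K^o (coord i : _ -> K^o) x
  [set y | `|coord i x - y| < e]).
by apply/nbhs_ballP; exists e => // y; rewrite -ball_normE.
Qed.

Lemma unit_cube_weak_closed : @closed (weak (finseq K)) unit_cube.
Proof.
move=> x xC i; rewrite real_leNgt ?normr_real ?real1//; apply/negP => x1.
(* By the triangle inequality, a weak neighbourhood of this radius in coordinate [i] misses the
   cube. *)
have d0 : 0 < `|coord i x| - 1 by rewrite subr_gt0.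
have [y [y1]] := xC _ (nbhs_weak_coord i x d0).
rewrite /= ltrBrDl => /lt_geF/negP; apply.
rewrite -{1}(subrK (coord i y) (coord i x)) addrC.
by rewrite (le_trans (ler_normD _ _))// lerD2r.
Qed.

(** * Failure of weak compactness and of completeness *)

Definition ones n : finseq K := \poly_(i < n) 1.

Lemma coord_ones n i : coord i (ones n) = (i < n)%:R.
Proof. by rewrite /coord coef_poly; case: ltnP. Qed.

Lemma unit_cube_ones n : unit_cube (ones n).
Proof. by move=> i; rewrite coord_ones; case: ltnP; rewrite ?normr1 ?normr0. Qed.

(** Past its support [x] is 0, while [ones n] is still 1 there for large [n]. So no [x] is a limit
    or a weak cluster point of [ones]. *)
Lemma ones_far x : exists i, forall n, (i < n)%N ->
  `|coord i x - coord i (ones n)| = 1.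
Proof.
exists (size (x : {poly K})) => n ltn.
by rewrite coord_ones ltn /coord nth_default// sub0r normrN1.
Qed.

Lemma unit_cube_not_weak_compact : ~ @compact (weak (finseq K)) unit_cube.
Proof.
move=> /(_ (ones @ \oo) _)[|x [_ xF]].
  by exists 0%N => // n _; exact: unit_cube_ones.
have [i far] := ones_far x.
have Fi : (ones @ \oo) (ones @` [set n | (i < n)%N]).
  by exists i.+1 => // n /= ltin; exists n.
have [_ [[n ltin <-]]] := xF _ _ Fi (nbhs_weak_coord i x ltr01).
by rewrite /= far// ltxx.
Qed.

Lemma finseq_not_complete : ~ tvs_complete (finseq K).
Proof.
move=> /(_ (ones @ \oo) _)[|x xF].
  move=> A [U [m [e [e0 mU]]] UA].
  (* All members of this tail agree on the first [m] coordinates, so their differences lie in every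
     box of length [m] around 0. *)
  have Fm : (ones @ \oo) (ones @` [set n | (m <= n)%N]).
    by exists m => // n /= lemn; exists n.
  exists (ones @` [set n | (m <= n)%N], ones @` [set n | (m <= n)%N]) => //.
  move=> [_ _] /= [[p mp <-] [q mq <-]]; apply/UA/mU => i im.
  rewrite coord0 coordB !coord_ones.
  by rewrite (leq_trans im mp) (leq_trans im mq) subrr subr0 normr0.
have [i far] := ones_far x.
have [N _ NF] := xF _ (nbhs_box x i.+1 ltr01).
have := NF (maxn N i.+1) (leq_maxl _ _) i (ltnSn i).
by rewrite far ?leq_maxr// ltxx.
Qed.

(** * Continuous functionals and their maxima on the cube *)

(* A functional bounded on a box vanishes on the subspace that the box
   contains. *)
Lemma dual_finseqE (phi : dual (finseq K)) : exists n, forall x,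
  sval phi x = \sum_(i < n) coord i x * sval phi ('X^i : {poly K}) :> K.
Proof.
case: phi => phi phic /=.
have /(phic 0) [n [e [e0 nphi]]] : nbhs (phi 0) (ball (phi 0 : K^o) 1).
  exact: nbhsx_ballx.
have ker x : (forall i, (i < n)%N -> coord i x = 0) -> phi x = 0.
  move=> x0; apply/eqP/negPn/negP => phix.
  (* Scaled to have value 1 under [phi], the vector still lies in the box, where [phi] has modulus
     below 1. *)
  have /nphi /= : box 0 n e ((phi x)^-1 *: x).
    by move=> i ni; rewrite coord0 coordZ x0// mulr0 subrr normr0.
  have -> : phi ((phi x)^-1 *: x) = 1 by rewrite linearZ; exact: mulVf.
  by rewrite -ball_normE /= linear0 sub0r normrN1 ltxx.
exists n => x; apply/eqP; rewrite -subr_eq0; apply/eqP.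
(* Subtracting the truncation of [x] leaves a vector whose first [n] coordinates vanish. *)
transitivity (phi (x - \sum_(i < n) coord i x *: ('X^i : finseq K))).
  rewrite linearB linear_sum; congr (_ - _); apply: eq_bigr => i _.
  by rewrite linearZ.
apply: ker => i ni; rewrite coordB.
rewrite (_ : \sum_(_ < n) _ = (\poly_(j < n) coord j x : {poly K})).
  by rewrite [X in _ - X]coef_poly ni subrr.
by rewrite poly_def.
Qed.

End Finseq.

(** Cancelling the phase of each coefficient [a i] gives [phi] the value [\sum_(i < n) |a i|], which
    bounds its modulus on the cube. *)
Lemma dual_unit_cube_max (K : numClosedFieldType) (phi : dual (finseq K)) :
  exists2 x, unit_cube x &
    forall y, unit_cube y -> `|sval phi y : K| <= `|sval phi x : K|.
Proof.
have [n phiE] := dual_finseqE phi.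
pose a i : K := sval phi ('X^i : {poly K}).
(* Where [a i = 0], division by zero yields the coordinate 0. *)
pose x : finseq K := \poly_(i < n) ((a i)^* / `|a i|).
have xi (i : 'I_n) : coord i x * a i = `|a i|.
  rewrite /coord coef_poly ltn_ord mulrAC [_^* * _]mulrC -normCK expr2.
  have [->|a0] := eqVneq `|a i| 0; first by rewrite !mul0r.
  by rewrite mulfK.
exists x.
  move=> i; rewrite /coord coef_poly; case: ltnP => _; last by rewrite normr0.
  rewrite normrM normfV normr_id norm_conjC.
  have [->|a0] := eqVneq `|a i| 0; first by rewrite mul0r.
  by rewrite divff.
move=> y y1; rewrite !phiE (eq_bigr _ (fun i _ => xi i)).
rewrite (@ger0_norm _ (\sum_(i < n) `|a i|)) ?sumr_ge0//.
rewrite (le_trans (ler_norm_sum _ _ _))//; apply: ler_sum => i _.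
by rewrite normrM ler_piMl.
Qed.

Theorem mainTheorem1 (R : realType) :
  exists (E : tvsType R[i]) (C : set E),
    [/\ hausdorff_space E,
        ~ tvs_complete E,
        [/\ convex_set C, tvs_bounded C & @closed (weak E) C],
        ~ @compact (weak E) C &
        forall phi : dual E, exists2 x : E, C x &
          (ComplexField.Normc.normc (sval phi x))%:E
            = ereal_sup [set (ComplexField.Normc.normc (sval phi y))%:E | y in C]].
Proof.
exists (finseq R[i]), (@unit_cube R[i]); split.
- exact: finseq_hausdorff.
- exact: finseq_not_complete.
- split; [exact: unit_cube_convex|exact: unit_cube_bounded|].
  exact: unit_cube_weak_closed.
- exact: unit_cube_not_weak_compact.
move=> phi; have [x x1 phix] := dual_unit_cube_max phi.
exists x => //; apply/eqP; rewrite eq_le; apply/andP; split.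
  by apply: ereal_sup_ubound; exists x.
(* [lecR] moves the inequality between real moduli into [R[i]], where the norm is the embedded
   [normc]. *)
apply: ge_ereal_sup => _ [y y1 <-]; rewrite lee_fin -lecR.
exact: phix.
Qed.
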